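(* Let $f:S\to S$ be a function on a finite set $S$ with $|S|=n$, and let $1<\ell\le n$. Let $v_\ell\in\mathcal V_\ell$ be an $f$-compatible left eigenvector of $F^{(\ell)}$, $v_\ell F^{(\ell)}=\lambda\,v_\ell$. Then $v_{\ell-1}=v_\ell\,E^{(\ell,\ell-1)}$ is an $f$-compatible left eigenvector of $F^{(\ell-1)}$ with the same eigenvalue $\lambda$.
   Context: $\mathcal P_\ell$ denotes the set of $\ell$-element subsets of $S$, and $\mathcal V_\ell$ the real vector space of row vectors $v=(v(I))_{I\in\mathcal P_\ell}$. A set $I\in\mathcal P_\ell$ is $f$-preserved if $f(I)\in\mathcal P_\ell$, i.e. $|f(I)|=|I|$. A vector $v\in\mathcal V_\ell$ is $f$-compatible if $v(I)\neq0$ implies that $I$ is $f$-preserved. The matrix $F^{(\ell)}$ is indexed by $\mathcal P_\ell\times\mathcal P_\ell$, with $F^{(\ell)}_{IJ}=1$ if $f(I)=J$ and $0$ otherwise. The matrix $E^{(\ell,\ell-1)}$ is indexed by $\mathcal P_\ell\times\mathcal P_{\ell-1}$, with $E^{(\ell,\ell-1)}_{IJ}=1$ if $J\subset I$ and $0$ otherwise.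
   Formalization: ''Left eigenvector with eigenvalue λ'' is read as vF = λv with the zero vector allowed, in hypothesis and conclusion, since v_{ℓ-1} can vanish for nonzero v_ℓ (f = id on {1,2,3,4}, ℓ = 2, v = [12]−[23]+[34]−[14]). *)

(* Defs.v *)
From HB Require Import structures.
From mathcomp Require Import all_boot all_order all_algebra.
From mathcomp Require Import reals.
Set Implicit Arguments.
Unset Strict Implicit.
Unset Printing Implicit Defensive.
Import Order.TTheory GRing.Theory Num.Theory.
Local Open Scope ring_scope.

Definition subsets (S : finType) (l : nat) : {set {set S}} :=
  [set I : {set S} | #|I| == l].

Definition nth_subset (S : finType) (l : nat) (i : 'I_#|subsets S l|) : {set S} :=
  enum_val i.

(* v(I) is the entry [v 0 i] with I = [nth_subset i]. *)
Definition rowspace (R : realType) (S : finType) (l : nat) :=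
  'rV[R]_#|subsets S l|.

Definition preserved (S : finType) (f : S -> S) (l : nat) (I : {set S}) : bool :=
  f @: I \in subsets S l.

Definition compatible (R : realType) (S : finType) (f : S -> S) (l : nat)
    (v : rowspace R S l) : Prop :=
  forall i : 'I_#|subsets S l|, v 0 i != 0 -> preserved f l (nth_subset i).

Definition Fmx (R : realType) (S : finType) (f : S -> S) (l : nat) :
    'M[R]_#|subsets S l| :=
  \matrix_(i, j) (f @: nth_subset i == nth_subset j)%:R.

Definition Emx (R : realType) (S : finType) (l : nat) :
    'M[R]_(#|subsets S l|, #|subsets S l.-1|) :=
  \matrix_(i, j) (nth_subset j \subset nth_subset i)%:R.

(* The zero vector is allowed, i.e. v lies in the left eigenspace of lambda:
   v *m Emx R S l may vanish when v does not.  For instance, for f = id on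
   {1, 2, 3, 4}, l = 2 and lambda = 1, take v = 1 on {1,2} and {3,4}, v = -1 on
   {2,3} and {1,4}, and v = 0 elsewhere. *)
Definition left_eigenvector (R : realType) (m : nat) (M : 'M[R]_m)
    (lambda : R) (v : 'rV[R]_m) : Prop :=
  v *m M = lambda *: v.

Arguments preserved {S} f l I.
Arguments compatible {R S} f {l} v.
Arguments Fmx R {S} f l.

(* Main.v *)
Require Import Defs.
From HB Require Import structures.
From mathcomp Require Import all_boot all_order all_algebra.
From mathcomp Require Import reals.
Set Implicit Arguments.
Unset Strict Implicit.
Unset Printing Implicit Defensive.
Import Order.TTheory GRing.Theory Num.Theory.
Local Open Scope ring_scope.

(** On an [f]-preserved set [I] the map [f] is injective, hence [J |-> f @: J] is
    a size-preserving bijection from the subsets of [I] to those of [f @: I].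
    Two things follow.  Every subset of [I] is [f]-preserved, so compatibility
    passes from [v] to [v *m E], whose entries are sums of entries of [v] over
    supersets ([compatible_mul_Emx]).  And, writing [F] and [F'] for the matrices of [f] on subsets of
    size [l] and [l.-1], the products [F *m E] and [E *m F'] have the same row
    at [I]: at [K], one records whether [K \subset f @: I] and the other counts
    the [J \subset I] of size [l.-1] with [f @: J = K]
    ([sum_subsets_imset], [row_Fmx_Emx_preserved]).  Since [v] vanishes at all other rows,
    [v E F' = v F E = lambda v E]. *)

Lemma preservedP (S : finType) (f : S -> S) (l : nat)
    (i : 'I_#|subsets S l|) :
  reflect {in nth_subset i &, injective f} (preserved f l (nth_subset i)).
Proof.
have /[!inE] /eqP cardI : nth_subset i \in subsets S l by exact: enum_valP.
by rewrite /preserved inE -[X in _ == X]cardI; exact: imset_injP.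
Qed.

(** Injectivity on [I] makes the only candidate for a preimage of [K] among the
    subsets of [I] the set of all points of [I] that [f] sends into [K]. *)
Lemma imset_eq_preimset (S T : finType) (f : S -> T) (I J : {set S})
    (K : {set T}) :
  {in I &, injective f} -> J \subset I -> f @: J = K -> J = I :&: f @^-1: K.
Proof.
move=> injf /subsetP sJI <-; apply/setP=> x; rewrite !inE.
apply/idP/andP=> [xJ|[xI /imsetP[y yJ /injf ->]]] //; last exact: sJI.
by split; [exact: sJI | exact: imset_f].
Qed.

Lemma imset_preimset (S T : finType) (f : S -> T) (I : {set S})
    (K : {set T}) :
  K \subset f @: I -> f @: (I :&: f @^-1: K) = K.
Proof.
move=> /subsetP sKI; apply/setP=> y; apply/imsetP/idP.
  by case=> x /[!inE] /andP[_ xK] ->.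
move=> yK; have /imsetP[x xI yE] := sKI y yK.
by exists x => //; rewrite !inE xI -yE.
Qed.

(** The sum has exactly one nonzero term, at [I :&: f @^-1: K], when [K] is
    covered by [f @: I], and none otherwise; that set has size [m] because [f]
    is injective on it. *)
Lemma sum_subsets_imset (R : pzSemiRingType) (S : finType) (f : S -> S)
    (m : nat) (I K : {set S}) :
  {in I &, injective f} -> K \in subsets S m ->
  \sum_(J in subsets S m) (J \subset I)%:R * (f @: J == K)%:R
    = (K \subset f @: I)%:R :> R.
Proof.
move=> injf; rewrite inE => /eqP cardK.
have [sKI|nsKI] := boolP (K \subset f @: I); last first.
  apply: big1 => J _; rewrite -natrM mulnb.
  case: andP => // -[sJI /eqP fJ].
  by rewrite -fJ imsetS in nsKI.
have sJI : I :&: f @^-1: K \subset I by exact: subsetIl.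
have fJ : f @: (I :&: f @^-1: K) = K by exact: imset_preimset.
have cardJ : I :&: f @^-1: K \in subsets S m.
  by rewrite inE -cardK -[in X in _ == X]fJ card_in_imset //;
     apply: sub_in2 injf; exact/subsetP.
rewrite (bigD1 _ cardJ) /= sJI fJ eqxx mulr1 big1 ?addr0 // => J /andP[_ neqJ].
rewrite -natrM mulnb; case: andP => // -[sJ /eqP fJK].
by rewrite (imset_eq_preimset injf sJ fJK) eqxx in neqJ.
Qed.

(** The two products differ in general: when [f] collapses [I], row [I] of the
    first is zero, while row [I] of the second is nonzero as soon as [f] is
    injective on some [J \subset I] of size [l.-1]. *)
Lemma row_Fmx_Emx_preserved (R : realType) (S : finType) (f : S -> S) (l : nat)
    (i : 'I_#|subsets S l|) :
  preserved f l (nth_subset i) ->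
  row i (Fmx R f l *m Emx R S l) = row i (Emx R S l *m Fmx R f l.-1).
Proof.
move=> pI; apply/rowP=> k; rewrite !mxE.
transitivity ((nth_subset k \subset f @: nth_subset i)%:R : R).
  (* Preservation puts [f @: I] among the column indices of [Fmx R f l]. *)
  have [j0 j0E] : exists j0 : 'I_#|subsets S l|, nth_subset j0 = f @: nth_subset i.
    have fI : f @: nth_subset i \in subsets S l by [].
    by exists (enum_rank_in fI (f @: nth_subset i)); exact: enum_rankK_in.
  rewrite (bigD1 j0) //= !mxE -j0E eqxx mul1r big1 ?addr0 // => j neqj.
  rewrite !mxE -j0E; case: eqP => [/enum_val_inj eqj|_]; last by rewrite mul0r.
  by rewrite eqj eqxx in neqj.
rewrite -(@sum_subsets_imset _ _ _ l.-1) ?enum_valP //; last exact/preservedP.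
by rewrite big_enum_val; apply: eq_bigr => j _; rewrite !mxE.
Qed.

Lemma compatible_mul_Emx (R : realType) (S : finType) (f : S -> S) (l : nat)
    (v : rowspace R S l) :
  compatible f v -> compatible f (v *m Emx R S l : rowspace R S l.-1).
Proof.
move=> compv k vEk; apply/preservedP.
have [i] : exists i, v 0 i * Emx R S l i k != 0.
  apply/existsP; apply: contraNT vEk => /existsPn vE0.
  by rewrite mxE big1 // => i _; apply/eqP; have /negPn := vE0 i.
rewrite mulf_eq0 negb_or mxE pnatr_eq0 eqb0 negbK => /andP[vi sKI].
by apply: sub_in2 (preservedP f i (compv i vi)); exact/subsetP.
Qed.

Theorem mainTheorem5 (R : realType) (S : finType) (f : S -> S) (n l : nat)
    (hn : #|S| = n) (hl : (1 < l <= n)%N)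
    (v : rowspace R S l) (lambda : R)
    (hcomp : compatible f v)
    (heig : left_eigenvector (Fmx R f l) lambda v) :
  compatible f (v *m Emx R S l : rowspace R S l.-1) /\
  left_eigenvector (Fmx R f l.-1) lambda (v *m Emx R S l).
Proof.
split; first exact: compatible_mul_Emx.
rewrite /left_eigenvector scalemxAl -heig -!mulmxA !(mulmx_sum_row v).
apply: eq_bigr => i _; have [->|/hcomp pI] := eqVneq (v 0 i) 0.
  by rewrite !scale0r.
by rewrite row_Fmx_Emx_preserved.
Qed.
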